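(* Let $k$ be a field of characteristic $0$, and for $N\ge 1$ let $P_N$, $D_1,\dots,D_N$ and $W_{\mathrm{perm}}(N)=\bigoplus_{i=1}^N P_ND_i$ be as in the context. With the bilinear bracket $$[aD_i,bD_j]_\circ:=\bigl(D_j(a)\cdot b\bigr)D_i-\bigl(a\cdot D_i(b)\bigr)D_j\qquad(a,b\in P_N),$$ $(W_{\mathrm{perm}}(N),[-,-]_\circ)$ is a Leibniz algebra. Moreover, for $N=2$ the bracket is given by the following multiplication table, for all $m,n,p,q\ge0$. (a) Left factor $E_{m,n}^{x,*}$: $$\begin{aligned} [E_{m,n}^{x,x},E_{p,q}^{x,x}]_\circ&=(m-p)E_{m+p+1,n+q}^{x,x},\\ [E_{m,n}^{x,x},E_{p,q}^{x,y}]_\circ&=nE_{m+p+1,n+q}^{x,x}-(p+1)E_{m+p+1,n+q}^{x,y},\\ [E_{m,n}^{x,y},E_{p,q}^{x,x}]_\circ&=(m+1)E_{m+p+1,n+q}^{x,y}-qE_{m+p+1,n+q}^{x,x},\\ [E_{m,n}^{x,y},E_{p,q}^{x,y}]_\circ&=(n-q)E_{m+p+1,n+q}^{x,y},\\ [E_{m,n}^{x,x},E_{p,q}^{y,x}]_\circ&=(m+1-p)E_{m+p+1,n+q}^{y,x},\\ [E_{m,n}^{x,x},E_{p,q}^{y,y}]_\circ&=nE_{m+p+1,n+q}^{y,x}-pE_{m+p+1,n+q}^{y,y},\\ [E_{m,n}^{x,y},E_{p,q}^{y,x}]_\circ&=(m+1)E_{m+p+1,n+q}^{y,y}-(q+1)E_{m+p+1,n+q}^{y,x},\\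 [E_{m,n}^{x,y},E_{p,q}^{y,y}]_\circ&=(n-q-1)E_{m+p+1,n+q}^{y,y}. \end{aligned}$$ (b) Left factor $E_{m,n}^{y,*}$: $$\begin{aligned} [E_{m,n}^{y,x},E_{p,q}^{x,x}]_\circ&=(m-p-1)E_{m+p,n+q+1}^{x,x},\\ [E_{m,n}^{y,x},E_{p,q}^{x,y}]_\circ&=(n+1)E_{m+p,n+q+1}^{x,x}-(p+1)E_{m+p,n+q+1}^{x,y},\\ [E_{m,n}^{y,y},E_{p,q}^{x,x}]_\circ&=mE_{m+p,n+q+1}^{x,y}-qE_{m+p,n+q+1}^{x,x},\\ [E_{m,n}^{y,y},E_{p,q}^{x,y}]_\circ&=(n+1-q)E_{m+p,n+q+1}^{x,y},\\ [E_{m,n}^{y,x},E_{p,q}^{y,x}]_\circ&=(m-p)E_{m+p,n+q+1}^{y,x},\\ [E_{m,n}^{y,x},E_{p,q}^{y,y}]_\circ&=(n+1)E_{m+p,n+q+1}^{y,x}-pE_{m+p,n+q+1}^{y,y},\\ [E_{m,n}^{y,y},E_{p,q}^{y,x}]_\circ&=mE_{m+p,n+q+1}^{y,y}-(q+1)E_{m+p,n+q+1}^{y,x},\\ [E_{m,n}^{y,y},E_{p,q}^{y,y}]_\circ&=(n-q)E_{m+p,n+q+1}^{y,y}. \end{aligned}$$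
   Context: Leibniz algebra means left Leibniz: $[[X,Y],Z]=[X,[Y,Z]]-[Y,[X,Z]]$. Let $A=k[x_1,\dots,x_N]$, $X=\{x_1,\dots,x_N\}$, $kX$ the vector space with basis $X$, and $P_N=A\otimes_k kX$, with $u\times x_j$ denoting $u\otimes x_j$ and product $(u\times x_r)\cdot(v\times x_s):=(uvx_r)\times x_s$. The maps $D_i:P_N\to P_N$ are the $k$-linear maps $D_i(u\times x_j)=(x_i\partial_i(u))\times x_j+\delta_{ij}\,u\times x_i$, where $\partial_i=\partial/\partial x_i$ and $\delta_{ij}$ is the Kronecker delta. $\bigoplus_{i=1}^N P_ND_i$ is the formal direct sum of $N$ copies of $P_N$, with $aD_i$ denoting $a$ in the $i$-th copy. For $N=2$ write $x=x_1$, $y=x_2$, $D_x=D_1$, $D_y=D_2$, $e^{x}_{m,n}=x^my^n\times x$, $e^{y}_{m,n}=x^my^n\times y$, and $E^{\alpha,i}_{m,n}=e^{\alpha}_{m,n}D_i$ for $\alpha,i\in\{x,y\}$, $m,n\ge0$. *)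

(* Defs.v *)
From mathcomp Require Import all_boot all_order all_algebra.
From mathcomp Require Import mpoly.
Set Implicit Arguments.
Unset Strict Implicit.
Unset Printing Implicit Defensive.
Import GRing.Theory.
Local Open Scope ring_scope.

(* A Leibniz algebra over k, in the left convention: the left multiplications
   are derivations of the bracket. *)
Definition left_Leibniz_algebra (k : fieldType) (V : lmodType k)
    (br : V -> V -> V) : Prop :=
  [/\ forall Z : V, linear (fun X => br X Z),
      forall X : V, linear (br X)
    & forall X Y Z : V, br (br X Y) Z = br X (br Y Z) - br Y (br X Z)].

(* A (x)_k kX, for A = k[x_1, .., x_N] and X = {x_1, .., x_N}, is the free
   A-module on X; [a : PN k N] stands for \sum_j a j (x) x_j. *)
Definition PN (k : fieldType) (N : nat) : lmodType k :=
  {ffun 'I_N -> {mpoly k[N]}}.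

(* u (x) x_j *)
Definition tens (k : fieldType) (N : nat) (u : {mpoly k[N]}) (j : 'I_N) :
    PN k N :=
  [ffun s => if s == j then u else 0].

(* mulP and DP extend to PN, (bi)linearly, the formulas that define them on
   pure tensors: see mulP_tens and DP_tens. *)
Definition mulP (k : fieldType) (N : nat) (a b : PN k N) : PN k N :=
  \sum_(r < N) \sum_(s < N) tens (a r * b s * 'X_r) s.

Definition DP (k : fieldType) (N : nat) (i : 'I_N) (a : PN k N) : PN k N :=
  \sum_(j < N) (tens ('X_i * mderiv i (a j)) j
                + (i == j)%:R *: tens (a j) i).

(* The formal direct sum of N copies of PN: X i is the component of X in the
   i-th copy, and [inD a i] is a D_i. *)
Definition Wperm (k : fieldType) (N : nat) : lmodType k :=
  {ffun 'I_N -> PN k N}.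

Definition inD (k : fieldType) (N : nat) (a : PN k N) (i : 'I_N) : Wperm k N :=
  [ffun l => if l == i then a else 0].

(* The biadditive extension of the formula of Wbracket_inD. *)
Definition Wbracket (k : fieldType) (N : nat) (X Y : Wperm k N) : Wperm k N :=
  \sum_(i < N) \sum_(j < N)
    (inD (mulP (DP j (X i)) (Y j)) i - inD (mulP (X i) (DP i (Y j))) j).

Definition vx : 'I_2 := ord0.
Definition vy : 'I_2 := ord_max.

Definition e (k : fieldType) (alpha : 'I_2) (m n : nat) : PN k 2 :=
  tens ('X_vx ^+ m * 'X_vy ^+ n) alpha.

Definition E (k : fieldType) (alpha i : 'I_2) (m n : nat) : Wperm k 2 :=
  inD (e k alpha m n) i.

Lemma tens_is_linear (k : fieldType) (N : nat) (j : 'I_N) :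
  linear (fun u : {mpoly k[N]} => tens u j).
Proof.
move=> c u v; apply/ffunP => s; rewrite !ffunE.
by case: (s == j) => //; rewrite scaler0 addr0.
Qed.

Lemma inD_is_linear (k : fieldType) (N : nat) (i : 'I_N) :
  linear (fun a : PN k N => inD a i).
Proof.
move=> c u v; apply/ffunP => s; rewrite !ffunE.
by case: (s == i) => //; rewrite scaler0 addr0.
Qed.

Lemma tens0 (k : fieldType) (N : nat) (j : 'I_N) :
  tens (0 : {mpoly k[N]}) j = 0.
Proof. by apply/ffunP => s; rewrite !ffunE if_same. Qed.

Lemma inD0 (k : fieldType) (N : nat) (i : 'I_N) : inD (0 : PN k N) i = 0.
Proof. by apply/ffunP => s; rewrite !ffunE if_same. Qed.

Lemma PN_tens_sum (k : fieldType) (N : nat) (a : PN k N) :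
  a = \sum_(j < N) tens (a j) j.
Proof.
apply/ffunP => s; rewrite sum_ffunE (bigD1 s) //= big1 ?addr0 ?ffunE ?eqxx //.
by move=> j js; rewrite ffunE eq_sym (negbTE js).
Qed.

Lemma Wperm_inD_sum (k : fieldType) (N : nat) (X : Wperm k N) :
  X = \sum_(i < N) inD (X i) i.
Proof.
apply/ffunP => s; rewrite sum_ffunE (bigD1 s) //= big1 ?addr0 ?ffunE ?eqxx //.
by move=> j js; rewrite ffunE eq_sym (negbTE js).
Qed.

Lemma DP_tens (k : fieldType) (N : nat) (i j : 'I_N) (u : {mpoly k[N]}) :
  DP i (tens u j) = tens ('X_i * mderiv i u) j + (i == j)%:R *: tens u i.
Proof.
rewrite /DP (bigD1 j) //= big1 ?addr0 ?ffunE ?eqxx //.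
move=> s /negbTE sj; rewrite ffunE sj mderiv0 mulr0 !tens0.
by rewrite scaler0 addr0.
Qed.

Lemma DP_is_linear (k : fieldType) (N : nat) (i : 'I_N) :
  linear (@DP k N i).
Proof.
move=> c a b; rewrite /DP scaler_sumr -big_split; apply: eq_bigr => j _ /=.
rewrite !ffunE linearP mulrDr -scalerAr !tens_is_linear !scalerDr !scalerA.
by rewrite [_%:R * c]mulrC addrACA.
Qed.

Lemma mulP_tens (k : fieldType) (N : nat) (r s : 'I_N) (u v : {mpoly k[N]}) :
  mulP (tens u r) (tens v s) = tens (u * v * 'X_r) s.
Proof.
rewrite /mulP (bigD1 r) //= [X in _ + X]big1 ?addr0; last first.
  move=> l /negbTE lr; rewrite big1 // => j _.
  by rewrite [tens u r l]ffunE lr !mul0r tens0.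
rewrite (bigD1 s) //= big1 ?addr0 ?ffunE ?eqxx // => l /negbTE ls.
by rewrite [tens v s l]ffunE ls mulr0 mul0r tens0.
Qed.

Lemma mulP_is_linear_l (k : fieldType) (N : nat) (b : PN k N) :
  linear (fun a => mulP a b).
Proof.
move=> c a a'; rewrite /mulP scaler_sumr -big_split; apply: eq_bigr => r _ /=.
rewrite scaler_sumr -big_split; apply: eq_bigr => s _ /=.
by rewrite !ffunE !mulrDl -!scalerAl tens_is_linear.
Qed.

Lemma mulP_is_linear_r (k : fieldType) (N : nat) (a : PN k N) :
  linear (mulP a).
Proof.
move=> c b b'; rewrite /mulP scaler_sumr -big_split; apply: eq_bigr => r _ /=.
rewrite scaler_sumr -big_split; apply: eq_bigr => s _ /=.
by rewrite !ffunE mulrDr mulrDl -scalerAr -scalerAl tens_is_linear.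
Qed.

Lemma Wbracket_inD (k : fieldType) (N : nat) (i j : 'I_N) (a b : PN k N) :
  Wbracket (inD a i) (inD b j)
  = inD (mulP (DP j a) b) i - inD (mulP a (DP i b)) j.
Proof.
have z0 (T U : lmodType k) (f : T -> U) : linear f -> f 0 = 0.
  by move=> lf; have := lf (-1) 0 0; rewrite scaler0 addr0 scaleN1r addNr.
have D0 l := z0 _ _ _ (@DP_is_linear k N l).
have m0r c := z0 _ _ _ (mulP_is_linear_r c).
have m0l c := z0 _ _ _ (mulP_is_linear_l c).
rewrite /Wbracket (bigD1 i) //= [X in _ + X]big1 ?addr0; last first.
  move=> l /negbTE li; rewrite big1 // => s _.
  by rewrite [inD a i l]ffunE li D0 !m0l !inD0 subr0.
rewrite (bigD1 j) //= big1 ?addr0 ?ffunE ?eqxx // => l /negbTE lj.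
by rewrite [inD b j l]ffunE lj D0 !m0r !inD0 subr0.
Qed.

(* Main.v *)
From HB Require Import structures.
Require Import Defs.
From mathcomp Require Import all_boot all_order all_algebra.
From mathcomp Require Import ring.
From mathcomp Require Import mpoly.
Import GRing.Theory.
Local Open Scope ring_scope.

(** Collapsing [\sum_r u_r (x) x_r] to [\sum_r u_r x_r] in [A] turns [D_i] into
    the Euler derivation [x_i d/dx_i], and [a . b] is the collapse of [a] acting
    on [b].  So [P_N] is an [A]-module on which the [D_i] commute and satisfy the
    Leibniz rule, and the Leibniz identity for [a D_i, b D_j, c D_l] becomes the
    Jacobi computation in the Witt algebra, [c] being the only module element.
    On monomials [D_i] is diagonal, with eigenvalue the total [x_i]-degree of
    [u x_j], whence the table. *)

Definition collapse {k : fieldType} {N : nat} (a : PN k N) : {mpoly k[N]} :=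
  \sum_(r < N) a r * 'X_r.

Definition euler {k : fieldType} {N : nat} (i : 'I_N) (u : {mpoly k[N]}) :
    {mpoly k[N]} :=
  'X_i * mderiv i u.

(** Packs a bare proof of [linear] into a linear map, to inherit the laws of such maps. *)
Lemma linear_morphs {k : fieldType} {U V : lmodType k} {f : U -> V} :
  linear f ->
  [/\ f 0 = 0, {morph f : x y / x + y}, {morph f : x y / x - y}
    & forall c, {morph f : x / c *: x}].
Proof.
move=> lin_f.
pose g : {linear U -> V} := HB.pack f (GRing.isLinear.Build k U V _ f lin_f).
by split; [exact: (raddf0 g) | exact: (raddfD g) | exact: (raddfB g)
          | exact: (linearZZ g)].
Qed.

(** * The algebra P_N and the operators D_i *)

Section PermAlgebra.
Context {k : fieldType} {N : nat}.
Implicit Types (a b c : PN k N) (i j l s : 'I_N) (u v : {mpoly k[N]}).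
Implicit Types (X Y Z : Wperm k N).

Lemma mderivXU i j : mderiv i ('X_j : {mpoly k[N]}) = (i == j)%:R.
Proof.
rewrite mderivX mnm1E [j == i]eq_sym.
case: eqVneq => [->|_]; rewrite ?scale0r // scale1r -[X in (X - _)%MM]add0m.
by rewrite addmK mpolyX0.
Qed.

Lemma mulPE a b s : mulP a b s = collapse a * b s.
Proof.
rewrite /mulP sum_ffunE /collapse mulr_suml; apply: eq_bigr => r _.
rewrite sum_ffunE (bigD1 s) //= big1 ?addr0 ?ffunE ?eqxx; first by ring.
by move=> j js; rewrite ffunE eq_sym (negbTE js).
Qed.

Lemma DPE i a s : DP i a s = euler i (a s) + (i == s)%:R * a s.
Proof.
rewrite /DP sum_ffunE (bigD1 s) //= big1 => [|j js].
  rewrite addr0 !ffunE eqxx; case: eqVneq => [->|is_].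
    by rewrite scale1r mul1r.
  by rewrite scale0r mul0r.
(* A summand j <> s could reach the component s only through the Kronecker term, which would need i
   = j and i = s at once. *)
rewrite !ffunE [s == j]eq_sym (negbTE js) add0r.
case: (eqVneq i j) => [->|_]; last by rewrite scale0r.
by rewrite eq_sym (negbTE js) scaler0.
Qed.

Lemma eulerD i u v : euler i (u + v) = euler i u + euler i v.
Proof. by rewrite /euler mderivD mulrDr. Qed.

Lemma eulerM i u v : euler i (u * v) = euler i u * v + u * euler i v.
Proof. by rewrite /euler mderivM; ring. Qed.

Lemma euler_natM i (n : nat) u : euler i (n%:R * u) = n%:R * euler i u.
Proof. by rewrite /euler !mulr_natl linearMn -mulrnAr. Qed.

Lemma eulerX i j : euler i ('X_j : {mpoly k[N]}) = (i == j)%:R * 'X_j.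
Proof.
by rewrite /euler mderivXU; case: eqVneq => [->|_] /=; ring.
Qed.

Lemma eulerC i j u : euler i (euler j u) = euler j (euler i u).
Proof.
rewrite /euler !mderivM !mderivXU mderiv_comm [j == i]eq_sym.
by case: eqVneq => [->|_] /=; ring.
Qed.

Lemma collapseD a b : collapse (a + b) = collapse a + collapse b.
Proof.
rewrite /collapse -big_split; apply: eq_bigr => r _ /=.
by rewrite ffunE mulrDl.
Qed.

(** The Kronecker term of D_i is what x_i d/dx_i yields on the factor x_r attached to component r,
    so the product rule for [euler] produces both terms. *)
Lemma collapse_DP i a : collapse (DP i a) = euler i (collapse a).
Proof.
rewrite /collapse /euler linear_sum mulr_sumr; apply: eq_bigr => r _.
by rewrite -/(euler i _) DPE eulerM eulerX; ring.
Qed.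

Lemma collapse_mulP a b : collapse (mulP a b) = collapse a * collapse b.
Proof.
rewrite {1 3}/collapse mulr_sumr; apply: eq_bigr => r _.
by rewrite mulPE mulrA.
Qed.

(** On a component, D_i is [euler] plus a constant. The constant stays with the right factor; on the
    left, [collapse_DP] turns D_i into [euler]. *)
Lemma DP_mulP i a b : DP i (mulP a b) = mulP (DP i a) b + mulP a (DP i b).
Proof.
apply/ffunP => s; rewrite [RHS]ffunE DPE !mulPE collapse_DP DPE eulerM.
by ring.
Qed.

Lemma DPC i j a : DP i (DP j a) = DP j (DP i a).
Proof.
apply/ffunP => s; rewrite [LHS]DPE [RHS]DPE (DPE j a) (DPE i a).
by rewrite !eulerD !euler_natM eulerC; ring.
Qed.

(** With a 0/1 scalar in place of the conditional, [ring] needs no case split on which copies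
    coincide. *)
Lemma inDE a i l s : inD a i l s = (l == i)%:R * a s.
Proof. by rewrite ffunE; case: eqP; rewrite ?mul1r // mul0r ffunE. Qed.

(** * Bilinearity of the bracket and the Leibniz identity *)

Lemma Wbracket_linear_l Z : linear (fun X => Wbracket X Z).
Proof.
move=> c X Y; rewrite /Wbracket scaler_sumr -big_split; apply: eq_bigr => i _ /=.
rewrite scaler_sumr -big_split; apply: eq_bigr => j _ /=.
rewrite !ffunE DP_is_linear !mulP_is_linear_l !inD_is_linear scalerBr opprD.
by rewrite addrACA.
Qed.

Lemma Wbracket_linear_r X : linear (Wbracket X).
Proof.
move=> c Y Z; rewrite /Wbracket scaler_sumr -big_split; apply: eq_bigr => i _ /=.
rewrite scaler_sumr -big_split; apply: eq_bigr => j _ /=.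
rewrite !ffunE DP_is_linear !mulP_is_linear_r !inD_is_linear scalerBr opprD.
by rewrite addrACA.
Qed.

Lemma WbracketDl X Y Z : Wbracket (X + Y) Z = Wbracket X Z + Wbracket Y Z.
Proof. by case: (linear_morphs (Wbracket_linear_l Z)) => _ ->. Qed.

Lemma WbracketBl X Y Z : Wbracket (X - Y) Z = Wbracket X Z - Wbracket Y Z.
Proof. by case: (linear_morphs (Wbracket_linear_l Z)) => _ _ ->. Qed.

Lemma Wbracket0l Z : Wbracket 0 Z = 0.
Proof. by case: (linear_morphs (Wbracket_linear_l Z)). Qed.

Lemma WbracketDr X Y Z : Wbracket X (Y + Z) = Wbracket X Y + Wbracket X Z.
Proof. by case: (linear_morphs (Wbracket_linear_r X)) => _ ->. Qed.

Lemma WbracketBr X Y Z : Wbracket X (Y - Z) = Wbracket X Y - Wbracket X Z.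
Proof. by case: (linear_morphs (Wbracket_linear_r X)) => _ _ ->. Qed.

Lemma Wbracket0r X : Wbracket X 0 = 0.
Proof. by case: (linear_morphs (Wbracket_linear_r X)). Qed.

(** Scalars are absorbed into the coefficients a, so sums of the a D_i already give everything. *)
Lemma Wperm_ind (P : Wperm k N -> Prop) :
  P 0 -> (forall X Y, P X -> P Y -> P (X + Y)) -> (forall a i, P (inD a i)) ->
  forall X, P X.
Proof. by move=> P0 PD PI X; rewrite [X]Wperm_inD_sum; elim/big_ind: _. Qed.

Lemma Wbracket_Leibniz_inD a b c i j l :
  Wbracket (Wbracket (inD a i) (inD b j)) (inD c l) =
  Wbracket (inD a i) (Wbracket (inD b j) (inD c l)) -
  Wbracket (inD b j) (Wbracket (inD a i) (inD c l)).
Proof.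
rewrite !Wbracket_inD !WbracketBl !WbracketBr !Wbracket_inD !DP_mulP.
(* With the definitions visible, the rewriting below would be very slow: it would
   unfold them in order to match [mulP _ _] or [inD _ _] with a sum. *)
move: inDE mulPE collapse_mulP DPC.
move: (@inD k N) (@mulP k N) (@DP k N) => I M D IE ME collapseM DC.
(* Each of a, b, c occurs under two operators in both orders; fixing one order gives [ring] equal
   atoms. The two terms in D_i D_j c then cancel because collapses commute in A. *)
rewrite (DC j i c) (DC l j a) (DC l i b).
apply/ffunP => t; apply/ffunP => s; rewrite !ffunE !IE !ME !ffunE !ME.
by rewrite !collapseD !collapseM; ring.
Qed.

Lemma Wbracket_Leibniz X Y Z :
  Wbracket (Wbracket X Y) Z =
  Wbracket X (Wbracket Y Z) - Wbracket Y (Wbracket X Z).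
Proof.
move: Wbracket0l Wbracket0r WbracketDl WbracketDr Wbracket_Leibniz_inD.
move: (@Wbracket k N) => br br0l br0r brDl brDr Leibniz_inD.
elim/Wperm_ind: X => [|X X' IH IH'|a i]; first by rewrite !br0l br0r subr0.
  by rewrite !brDl IH IH' brDr opprD addrACA.
elim/Wperm_ind: Y => [|Y Y' IH IH'|b j]; first by rewrite !(br0l, br0r) subr0.
  by rewrite !(brDl, brDr) IH IH' opprD addrACA.
elim/Wperm_ind: Z => [|Z Z' IH IH'|c l]; first by rewrite !br0r subr0.
  by rewrite !brDr IH IH' opprD addrACA.
exact: Leibniz_inD.
Qed.

End PermAlgebra.

(** * The multiplication table for N = 2 *)

Section Table.
Context {k : fieldType}.
Implicit Types (alpha beta i j : 'I_2) (m n p q : nat).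

Lemma euler_exp {N : nat} (i j : 'I_N) m :
  euler i ('X_j ^+ m : {mpoly k[N]}) = ((i == j) * m)%:R * 'X_j ^+ m.
Proof.
elim: m => [|m IH].
  by rewrite muln0 mul0r expr0 /euler -mpolyC1 mderivC mulr0.
by rewrite exprS eulerM IH eulerX mulnS natrD; ring.
Qed.

Lemma DP_e i alpha m n :
  DP i (e k alpha m n)
  = ((i == vx) * m + (i == vy) * n + (i == alpha))%:R *: e k alpha m n.
Proof.
apply/ffunP => s; rewrite DPE !ffunE; case: eqVneq => [->|_]; last first.
  by rewrite /euler mderiv0 !mulr0 addr0 scaler0.
by rewrite eulerM !euler_exp [RHS]scaler_nat -[RHS]mulr_natl !natrD; ring.
Qed.

(** The letter x of the left factor moves into the coefficient, whence the extra 1 in the first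
    exponent. *)
Lemma mulP_ex alpha m n p q :
  mulP (e k vx m n) (e k alpha p q) = e k alpha (m + p + 1) (n + q).
Proof. by rewrite /e mulP_tens !exprD expr1; congr tens; ring. Qed.

Lemma mulP_ey alpha m n p q :
  mulP (e k vy m n) (e k alpha p q) = e k alpha (m + p) (n + q + 1).
Proof. by rewrite /e mulP_tens !exprD expr1; congr tens; ring. Qed.

(** D_j and D_i only rescale basis elements, so both terms share one product and all sixteen entries
    are instances of one formula. *)
Lemma Wbracket_E alpha beta i j m n p q :
  Wbracket (E k alpha i m n) (E k beta j p q)
  = ((j == vx) * m + (j == vy) * n + (j == alpha))%:R *:
      inD (mulP (e k alpha m n) (e k beta p q)) i
  - ((i == vx) * p + (i == vy) * q + (i == beta))%:R *:
      inD (mulP (e k alpha m n) (e k beta p q)) j.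
Proof.
have [_ _ _ mulPZl] := linear_morphs (mulP_is_linear_l (e k beta p q)).
have [_ _ _ mulPZr] := linear_morphs (mulP_is_linear_r (e k alpha m n)).
have inDZ l := let: And4 _ _ _ h := linear_morphs (@inD_is_linear k 2 l) in h.
by rewrite /E Wbracket_inD !DP_e mulPZl mulPZr !inDZ.
Qed.

End Table.

Theorem corollary7p7 (k : fieldType) (char_k : [pchar k] =i pred0) :
  (forall N : nat, (1 <= N)%N -> left_Leibniz_algebra (@Wbracket k N)) /\
  (forall m n p q : nat,
   (   Wbracket (E k vx vx m n) (E k vx vx p q)
      = (m%:R - p%:R) *: E k vx vx (m + p + 1) (n + q)
    /\ Wbracket (E k vx vx m n) (E k vx vy p q)
      = n%:R *: E k vx vx (m + p + 1) (n + q) - p.+1%:R *: E k vx vy (m + p + 1) (n + q)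
    /\ Wbracket (E k vx vy m n) (E k vx vx p q)
      = m.+1%:R *: E k vx vy (m + p + 1) (n + q) - q%:R *: E k vx vx (m + p + 1) (n + q)
    /\ Wbracket (E k vx vy m n) (E k vx vy p q)
      = (n%:R - q%:R) *: E k vx vy (m + p + 1) (n + q)
    /\ Wbracket (E k vx vx m n) (E k vy vx p q)
      = (m.+1%:R - p%:R) *: E k vy vx (m + p + 1) (n + q)
    /\ Wbracket (E k vx vx m n) (E k vy vy p q)
      = n%:R *: E k vy vx (m + p + 1) (n + q) - p%:R *: E k vy vy (m + p + 1) (n + q)
    /\ Wbracket (E k vx vy m n) (E k vy vx p q)
      = m.+1%:R *: E k vy vy (m + p + 1) (n + q) - q.+1%:R *: E k vy vx (m + p + 1) (n + q)
    /\ Wbracket (E k vx vy m n) (E k vy vy p q)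
      = (n%:R - q%:R - 1) *: E k vy vy (m + p + 1) (n + q))
   /\
   (   Wbracket (E k vy vx m n) (E k vx vx p q)
      = (m%:R - p%:R - 1) *: E k vx vx (m + p) (n + q + 1)
    /\ Wbracket (E k vy vx m n) (E k vx vy p q)
      = n.+1%:R *: E k vx vx (m + p) (n + q + 1) - p.+1%:R *: E k vx vy (m + p) (n + q + 1)
    /\ Wbracket (E k vy vy m n) (E k vx vx p q)
      = m%:R *: E k vx vy (m + p) (n + q + 1) - q%:R *: E k vx vx (m + p) (n + q + 1)
    /\ Wbracket (E k vy vy m n) (E k vx vy p q)
      = (n.+1%:R - q%:R) *: E k vx vy (m + p) (n + q + 1)
    /\ Wbracket (E k vy vx m n) (E k vy vx p q)
      = (m%:R - p%:R) *: E k vy vx (m + p) (n + q + 1)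
    /\ Wbracket (E k vy vx m n) (E k vy vy p q)
      = n.+1%:R *: E k vy vx (m + p) (n + q + 1) - p%:R *: E k vy vy (m + p) (n + q + 1)
    /\ Wbracket (E k vy vy m n) (E k vy vx p q)
      = m%:R *: E k vy vy (m + p) (n + q + 1) - q.+1%:R *: E k vy vx (m + p) (n + q + 1)
    /\ Wbracket (E k vy vy m n) (E k vy vy p q)
      = (n%:R - q%:R) *: E k vy vy (m + p) (n + q + 1))).

Proof.
split=> [N _|m n p q].
  by split; [exact: Wbracket_linear_l | exact: Wbracket_linear_r
            | exact: Wbracket_Leibniz].
(* For i <> j the terms lie in different copies and match the table as they stand; for i = j they
   merge, and only the coefficients remain to compare. *)
do !split; rewrite Wbracket_E ?(mulP_ex, mulP_ey) /=
  !(mul1n, mul0n, add0n, addn0, addn1) // -scalerBl; congr (_ *: _); ring.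
Qed.
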